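(* Let $G$ be a Garside group with Garside element $\Delta$, let $x\in G$ and $q\in\mathbb{Z}$. If $\inf x<q\le \mathrm{inf}_s\,x$ or $\mathrm{sup}_s\,x\le q<\sup x$, then $x\notin G_q$.
   Context: Garside groups. A monoid $M$ is atomic if it is generated by its atoms (elements $x\ne1$ such that $x=yz$ implies $y=1$ or $z=1$) and every $x\in M$ has a finite norm $\|x\|$, the maximal number of factors in an expression of $x$ as a product of atoms. A Garside monoid is a cancellative atomic monoid $M$ in which any two elements have left and right greatest common divisors and left and right least common multiples, together with a Garside element $\Delta\in M$: its left divisors coincide with its right divisors, and they form a finite set $S$ (the simple elements) generating $M$. A Garside group $G$ is the group of fractions of a Garside monoid $M$. For $x,y\in G$, $x\prec y$ means $x^{-1}y\in M$ (a partial order on $G$), and $x\wedge y$, $x\vee y$ are the greatest lower bound and least upper bound with respect to $\prec$. Write $x^u=u^{-1}xu$. Every $x\in G$ has a unique normal form $x=\Delta^p x_1\cdots x_l$ with $x_i\in S\setminus\{1,\Delta\}$ and $x\wedge\Delta^{p+i}=\Delta^p x_1\cdots x_i$ for $0\le i\le l$; put $\inf x=p$, $\sup x=p+l$. (Equivalently, $\inf x$ is the largest $p$ with $\Delta^p\prec x$ and $\sup x$ the smallest $p$ with $x\prec\Delta^p$.) Let $C(x)$ be the conjugacy class of $x$ in $G$, $\mathrm{inf}_s\,x=\max\{\inf y\mid y\in C(x)\}$ and $\mathrm{sup}_s\,x=\min\{\sup y\mid y\in C(x)\}$. For $q\in\mathbb{Z}$ the cycling operation of order $q$ is $\mathrm{c}_q(x)=x^{x\wedge\Delta^q}$,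 and $G_q=\{x\in G\mid \mathrm{c}_q^N(x)=x\text{ for some }N>0\}$. *)

(* Defs.v *)
From mathcomp Require Import all_boot all_order all_algebra.
From mathcomp Require Import all_classical.

Set Implicit Arguments.
Unset Strict Implicit.
Unset Printing Implicit Defensive.

Local Open Scope classical_set_scope.
Local Open Scope group_scope.

Definition is_glb (T : Type) (R : T -> T -> Prop) (x y d : T) : Prop :=
  [/\ R d x, R d y & forall e, R e x -> R e y -> R e d].

Definition is_lub (T : Type) (R : T -> T -> Prop) (x y m : T) : Prop :=
  [/\ R x m, R y m & forall e, R x e -> R y e -> R m e].

Section GarsideMonoid.
Variable M : monoidType.
Implicit Types a b x y z : M.

Definition left_divides a b : Prop := exists c, b = a * c.
Definition right_divides a b : Prop := exists c, b = c * a.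

Definition atom x : Prop :=
  x <> 1 /\ forall y z, x = y * z -> y = 1 \/ z = 1.

Definition atom_expression x (s : seq M) : Prop :=
  (forall a, a \in s -> atom a) /\ x = \prod_(a <- s) a.

Definition is_norm x (n : nat) : Prop :=
  (exists2 s, atom_expression x s & size s = n) /\
  (forall s, atom_expression x s -> (size s <= n)%N).

Definition atomic : Prop :=
  (forall x, exists s, atom_expression x s) /\
  (forall x, exists n, is_norm x n).

Definition simple_elements (Delta : M) : set M := [set s | left_divides s Delta].

Record garside_monoid (Delta : M) : Prop := GarsideMonoid {
  garside_cancell : forall a x y, a * x = a * y -> x = y;
  garside_cancelr : forall a x y, x * a = y * a -> x = y;
  garside_atomic : atomic;
  garside_left_gcd : forall x y, exists d, is_glb left_divides x y d;
  garside_right_gcd : forall x y, exists d, is_glb right_divides x y d;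
  garside_left_lcm : forall x y, exists m, is_lub left_divides x y m;
  garside_right_lcm : forall x y, exists m, is_lub right_divides x y m;
  garside_divisors : forall s, left_divides s Delta <-> right_divides s Delta;
  garside_simple_finite : finite_set (simple_elements Delta);
  garside_simple_gen : forall x, exists2 s : seq M,
    (forall a, a \in s -> simple_elements Delta a) & x = \prod_(a <- s) a
}.

End GarsideMonoid.

(* In a Garside monoid any two elements have common multiples on both sides,
   so left fractions suffice: every left fraction is also a right fraction. *)
Record group_of_fractions (M : monoidType) (G : groupType) (iota : M -> G) :
    Prop := GroupOfFractions {
  fractions_morph1 : iota 1 = 1;
  fractions_morphM : forall a b, iota (a * b) = iota a * iota b;
  fractions_inj : injective iota;
  fractions_surj : forall g, exists a b, g = (iota a)^-1 * iota b
}.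

Definition expgz (G : groupType) (x : G) (p : int) : G :=
  match p with Posz n => x ^+ n | Negz n => x ^- n.+1 end.

Section GarsideGroup.
Variables (M : monoidType) (G : groupType) (iota : M -> G) (Delta : M).
Implicit Types (x y : G) (p q : int) (s : seq M).

Local Notation Dz p := (expgz (iota Delta) p).

Definition prec x y : Prop := exists m : M, x^-1 * y = iota m.

(* [prec] is antisymmetric and lattice meets exist in a Garside group, so the
   default value 1 is never used. *)
Definition meet x y : G := xget 1 [set d | is_glb prec x y d].

Definition normal_form x p s : Prop :=
  [/\ forall a, a \in s -> [/\ simple_elements Delta a, a <> 1 & a <> Delta],
      x = Dz p * \prod_(a <- s) iota a &
      forall i : nat, (i <= size s)%N ->
        meet x (Dz (p + i%:Z)%R) = Dz p * \prod_(a <- take i s) iota a].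

(* Normal forms exist, and are unique unless Delta = 1; in that degenerate case
   G is trivial and [inf] and [sup] are constant. *)
Definition inf x : int := xget 0%R [set p | exists s, normal_form x p s].

Definition sup x : int :=
  xget 0%R [set r | exists p s, normal_form x p s /\ r = (p + (size s)%:Z)%R].

Definition conj_class x : set G := [set x ^ u | u in [set: G]].

(* Both extrema are attained in a Garside group. *)
Definition inf_s x : int :=
  xget 0%R (let A := inf @` conj_class x in A `&` ubound A).

Definition sup_s x : int :=
  xget 0%R (let A := sup @` conj_class x in A `&` lbound A).

Definition cycling q x : G := x ^ meet x (Dz q).

Definition cyclic_set q : set G :=
  [set x | exists2 N : nat, (0 < N)%N & iter N (cycling q) x = x].

End GarsideGroup.

(* Main.v *)
(* Suppose some conjugate [y] of [x] satisfies [Delta ^ q ≼ y].  Up to a power of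
   [Delta] the conjugator can be taken to be the inverse of a positive element
   [v], and then [v^-1 Delta ^ q ≼ x ∧ Delta ^ q], so that cycling conjugates by
   an initial part of the way from [x] to [y]: the remaining conjugator has
   smaller norm unless already [Delta ^ q ≼ x].  Hence some iterate of the
   cycling has infimum at least [q]; this persists under cycling, so a periodic
   [x] has [inf x >= q].  The argument for [sup] is the same, with
   [x v^-1 ≼ x ∧ Delta ^ q]. *)
Require Import Defs.
From mathcomp Require Import all_boot all_order all_algebra.
From mathcomp Require Import all_classical.
From mathcomp Require Import zify.

(** * Extrema of bounded sets of integers *)

Section IntExtrema.
Local Open Scope ring_scope.

Lemma int_has_max (P : int -> Prop) (b : int) :
  (exists p, P p) -> (forall p, P p -> p <= b) ->
  exists2 p, P p & forall r, P r -> r <= p.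
Proof.
move=> [p Pp] Pb.
have exP : exists n : nat, `[< P (b - n%:Z) >].
  exists `|b - p|%N; apply/asboolP.
  by have pb := Pb _ Pp; rewrite (_ : b - _ = p); last lia.
case: (ex_minnP exP) => n /asboolP Pn minn.
exists (b - n%:Z) => // r Pr.
have := minn `|b - r|%N; have := Pb _ Pr => rb.
rewrite (_ : b - `|b - r|%N%:Z = r); last lia.
by move/(_ (asboolT Pr)); lia.
Qed.

Lemma int_has_min (P : int -> Prop) (b : int) :
  (exists p, P p) -> (forall p, P p -> b <= p) ->
  exists2 p, P p & forall r, P r -> p <= r.
Proof.
move=> [p Pp] Pb.
have [||m Pm maxm] := @int_has_max (fun r => P (- r)) (- b).
- by exists (- p); rewrite GRing.opprK.
- by move=> r /Pb; lia.
exists (- m) => // r Pr.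
by have := maxm (- r); rewrite GRing.opprK => /(_ Pr); lia.
Qed.

End IntExtrema.

(** * The norm of an atomic monoid *)

Section AtomicMonoid.
Set Implicit Arguments.
Unset Strict Implicit.
Local Open Scope group_scope.
Variable M : monoidType.
Hypothesis atM : atomic M.
Implicit Types a b : M.

(** Appending an atom expression of [b], nonempty since [b <> 1], to a longest expression of [a]
    gives a strictly longer expression of [a * b]. *)
Lemma norm_mulr_lt a b m n :
  is_norm a m -> is_norm (a * b) n -> b <> 1 -> (m < n)%N.
Proof.
move=> [[s [sa ->] <-] _] [_ leqn] bn1.
have [t [ta bE]] := atM.1 b; subst b.
move: (leqn (s ++ t)) => {leqn}; rewrite /atom_expression size_cat big_cat /=.
case: t bn1 ta => [|c t] bn1 ta; first by rewrite big_nil in bn1.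
rewrite /= addnS => le; apply: leq_trans (le _); first by rewrite ltnS leq_addr.
by split=> // d; rewrite mem_cat => /orP[/sa|/ta].
Qed.

(** If neither factor were 1, norms would increase strictly from [1] to [a] and from [a] to
    [a * b = 1]. *)
Lemma mulm_eq1 a b : a * b = 1 -> b = 1.
Proof.
move=> ab1; apply: contrapT => bn1.
have an1 : a <> 1 by move=> a1; apply: bn1; rewrite -ab1 a1 mul1g.
have [m am] := atM.2 a; have [n n1] := atM.2 1.
have mn : (m < n)%N by apply: (norm_mulr_lt am _ bn1); rewrite ab1.
have : (n < m)%N by apply: (norm_mulr_lt n1 _ an1); rewrite mul1g.
by lia.
Qed.

End AtomicMonoid.

(** * Integer powers in a group *)

Section IntegerPowers.
Set Implicit Arguments.
Unset Strict Implicit.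
Local Open Scope group_scope.
Variable G : groupType.
Implicit Types (x y : G) (p q : int).

Lemma expgzS x p : expgz x (p + 1)%R = expgz x p * x.
Proof.
case: p => [n|[|n]].
- by rewrite (_ : (n%:Z + 1)%R = n.+1) /= ?expgSr //; lia.
- by rewrite /= expg1 mulVg.
rewrite (_ : (Negz n.+1 + 1)%R = Negz n); last lia.
by rewrite /= (expgS x n.+1) invgM mulgVK.
Qed.

Lemma expgzD x p q : expgz x (p + q)%R = expgz x p * expgz x q.
Proof.
elim/int_rect: q => [|n IH|n IH].
- by rewrite GRing.addr0 mulg1.
- rewrite (_ : (p + n.+1)%R = (p + n + 1)%R); last lia.
  rewrite (_ : (n.+1%:Z = n%:Z + 1)%R); last lia.
  by rewrite !expgzS IH mulgA.
apply: (@mulIg _ x); rewrite -mulgA -!expgzS.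
rewrite (_ : (p - n.+1%:Z + 1)%R = (p - n%:Z)%R); last lia.
by rewrite (_ : (- n.+1%:Z + 1)%R = (- n%:Z)%R) //; last lia.
Qed.

Lemma expgzN x p : expgz x (- p)%R = (expgz x p)^-1.
Proof.
by apply/esym/mulg1_eq; rewrite -expgzD GRing.subrr.
Qed.

Lemma expgz_conj x p q : expgz x p ^ expgz x q = expgz x p.
Proof. by rewrite conjgE -!expgzN -!expgzD; congr expgz; lia. Qed.

End IntegerPowers.

(** * The order of a Garside group and its behaviour under powers of [Delta] *)

Section GarsideGroupOrder.
Set Implicit Arguments.
Unset Strict Implicit.
Local Open Scope group_scope.
Variables (M : monoidType) (G : groupType) (iota : M -> G) (Delta : M).
Hypothesis HM : garside_monoid Delta.
Hypothesis HG : group_of_fractions iota.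
Implicit Types (x y z u v : G) (p q r : int) (m w : M).

Local Notation D p := (expgz (iota Delta) p).
Local Notation "x ≼ y" := (prec iota x y) (at level 70).

Let atM := garside_atomic HM.
Let iotaM := fractions_morphM HG.
Let iota1 := fractions_morph1 HG.

Definition positive x := exists m, x = iota m.

Lemma positive1 : positive 1.
Proof. by exists 1; rewrite iota1. Qed.

Lemma positiveM x y : positive x -> positive y -> positive (x * y).
Proof. by move=> [m ->] [n ->]; exists (m * n); rewrite iotaM. Qed.

Lemma positive_anti x : positive x -> positive x^-1 -> x = 1.
Proof.
move=> [m xm] [n xn]; rewrite xm (_ : m = 1) //.
by apply: (mulm_eq1 atM (a := n)); apply: (fractions_inj HG);
  rewrite iotaM -xm -xn mulVg iota1.
Qed.

Lemma prec_refl x : x ≼ x.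
Proof. by rewrite /prec mulVg; exact: positive1. Qed.

Lemma prec_trans y x z : x ≼ y -> y ≼ z -> x ≼ z.
Proof.
move=> xy yz; rewrite /prec (_ : x^-1 * z = (x^-1 * y) * (y^-1 * z)).
  exact: positiveM.
by rewrite !gnorm.
Qed.

Lemma prec_anti x y : x ≼ y -> y ≼ x -> x = y.
Proof.
move=> xy yx; have /divg1_eq/invg_inj -> // : x^-1 / y^-1 = 1.
by apply: positive_anti; rewrite invgK // invgM invgK.
Qed.

Lemma prec_mul2l z x y : z * x ≼ z * y <-> x ≼ y.
Proof. by rewrite /prec invgM -mulgA mulKg. Qed.

Lemma prec_mulr x y : positive y -> x ≼ x * y.
Proof. by rewrite /prec mulKg. Qed.

Lemma prec_mulVr x y : positive y -> x * y^-1 ≼ x.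
Proof. by rewrite /prec invgM invgK mulgVK. Qed.

(** It suffices to treat a simple [a]. Write [Delta = a * t]; the right divisor [t] is also a left
    divisor, [Delta = t * r], so [a * Delta = a * t * r = Delta * r]. The next lemma is the mirror
    image. *)
Lemma positive_conj1 x : positive x -> positive (x ^ iota Delta).
Proof.
move=> [m ->]; have [s ss ->] := garside_simple_gen HM m.
elim: s ss => [|a s IH] ss.
  by rewrite big_nil iota1 conj1g; exact: positive1.
rewrite big_cons iotaM conjMg; apply: positiveM; last first.
  by apply: IH => b bs; apply: ss; rewrite inE bs orbT.
have [t Dat] : left_divides a Delta by apply: ss; rewrite mem_head.
have /(garside_divisors HM) [r Dtr] : right_divides t Delta by exists a.
exists r; rewrite conjgE -iotaM; apply: (mulgI (iota Delta)).
by rewrite mulVKg -iotaM {1}Dtr mulgA -Dat.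
Qed.

Lemma positive_conjV1 x : positive x -> positive (x ^ (iota Delta)^-1).
Proof.
move=> [m ->]; have [s ss ->] := garside_simple_gen HM m.
elim: s ss => [|a s IH] ss.
  by rewrite big_nil iota1 conj1g; exact: positive1.
rewrite big_cons iotaM conjMg; apply: positiveM; last first.
  by apply: IH => b bs; apply: ss; rewrite inE bs orbT.
have /(garside_divisors HM) [t Dta] : left_divides a Delta.
  by apply: ss; rewrite mem_head.
have /(garside_divisors HM) [r Drt] : left_divides t Delta by exists a.
exists r; rewrite conjgE invgK mulgA -iotaM.
by rewrite {1}Drt -mulgA -Dta iotaM mulgK.
Qed.

Lemma positive_conj x p : positive x -> positive (x ^ D p).
Proof.
elim/int_rect: p => [|n IH|n IH] px.
- by rewrite conjg1.
- rewrite (_ : (n.+1%:Z = n%:Z + 1)%R); last lia.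
  by rewrite expgzS conjgM; apply/positive_conj1/IH.
rewrite (_ : (- n.+1%:Z)%R = (- n%:Z + -1)%R); last lia.
by rewrite expgzD conjgM; apply/positive_conjV1/IH.
Qed.

Lemma prec_conj x y p : x ≼ y -> x ^ D p ≼ y ^ D p.
Proof. by move=> /(@positive_conj _ p); rewrite conjMg conjVg. Qed.

(** The order is invariant under left translations only; powers of [Delta] may also act on the right
    because conjugation by them preserves positivity. *)
Lemma prec_mul2r x y p : x ≼ y -> x * D p ≼ y * D p.
Proof.
by move=> /(@positive_conj _ p); rewrite conjgE /prec invgM !mulgA.
Qed.

Lemma prec_expM x y p q : D p ≼ x -> D q ≼ y -> D (p + q)%R ≼ x * y.
Proof.
move=> px qy; rewrite expgzD; apply: (prec_trans (prec_mul2r q px)).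
by apply/prec_mul2l.
Qed.

Lemma expM_prec x y p q : x ≼ D p -> y ≼ D q -> x * y ≼ D (p + q)%R.
Proof.
move=> px qy; rewrite expgzD; apply: (prec_trans _ (prec_mul2r q px)).
by apply/prec_mul2l.
Qed.

Lemma prec_expX x p n : D p ≼ x -> D (p * n%:Z)%R ≼ x ^+ n.
Proof.
move=> px; elim: n => [|n IH]; first by rewrite GRing.mulr0; exact: prec_refl.
by rewrite (_ : (p * n.+1%:Z)%R = (p + p * n%:Z)%R) ?expgS; [exact: prec_expM|lia].
Qed.

Lemma expX_prec x p n : x ≼ D p -> x ^+ n ≼ D (p * n%:Z)%R.
Proof.
move=> px; elim: n => [|n IH]; first by rewrite GRing.mulr0; exact: prec_refl.
by rewrite (_ : (p * n.+1%:Z)%R = (p + p * n%:Z)%R) ?expgS; [exact: expM_prec|lia].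
Qed.

(** * Bounds by powers of [Delta], and meets *)

Lemma positive_expDelta (n : nat) : positive (D n).
Proof.
elim: n => [|n IH]; first exact: positive1.
by rewrite /= expgS; apply: positiveM => //; exists Delta.
Qed.

Lemma prec_expDelta p q : (p <= q)%R -> D p ≼ D q.
Proof.
move=> pq; have -> : q = (p + `|q - p|%N%:Z)%R by lia.
by rewrite expgzD; apply/prec_mulr/positive_expDelta.
Qed.

Lemma monoid_bound m : exists n : nat, iota m ≼ D n.
Proof.
have [s ss ->] := garside_simple_gen HM m.
elim: s ss => [|a s IH] ss.
  by exists 0; rewrite big_nil iota1; exact: prec_refl.
have [|n sn] := IH; first by move=> b bs; apply: ss; rewrite inE bs orbT.
exists n.+1; rewrite big_cons iotaM -add1n PoszD.
apply: expM_prec => //; have [t ->] : left_divides a Delta.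
  by apply: ss; rewrite mem_head.
by rewrite /= expg1 iotaM; apply: prec_mulr; exists t.
Qed.

Lemma lower_bound x : exists p, D p ≼ x.
Proof.
have [a [b ->]] := fractions_surj HG x; have [n an] := monoid_bound a.
exists (- n%:Z)%R; apply: (@prec_trans (iota a)^-1); last first.
  by apply: prec_mulr; exists b.
rewrite expgzN /prec invgK; have := positive_conj (- n%:Z)%R an.
by rewrite expgzN conjgE invgK mulgK.
Qed.

Lemma upper_bound x : exists p, x ≼ D p.
Proof.
have [p px] := lower_bound x^-1; exists (- p)%R.
have := positive_conj (- p)%R px.
by rewrite /prec conjgE expgzN invgK -!mulgA mulVKg.
Qed.

(** A left translation moves [x] and [y] to elements [c], [b] of the monoid, whose left gcd is [d].
    The point is that [d] also dominates lower bounds lying outside the monoid. *)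
Lemma meet_exists x y : exists d, is_glb (prec iota) x y d.
Proof.
have [c [b xy]] := fractions_surj HG (x^-1 * y).
have xE : x = x / iota c * iota c by rewrite mulgVK.
have yE : y = x / iota c * iota b by rewrite -mulgA -xy mulVKg.
have [d [[c' cE] [b' bE] dmax]] := garside_left_gcd HM c b.
exists (x / iota c * iota d); split=> [| |e ex ey].
- by rewrite {2}xE cE iotaM mulgA; apply: prec_mulr; exists c'.
- by rewrite yE bE iotaM mulgA; apply: prec_mulr; exists b'.
have [f [g eE]] := fractions_surj HG ((x / iota c)^-1 * e).
have eE' : e = x / iota c * ((iota f)^-1 * iota g) by rewrite -eE mulVKg.
have dvd m : (iota f)^-1 * iota g ≼ iota m -> left_divides g (f * m).
  rewrite /prec invgM invgK => -[h hE]; exists h; apply: (fractions_inj HG).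
  by rewrite !iotaM -hE !mulgA gsimp mul1g.
have gc : left_divides g (f * c).
  by apply/dvd/(prec_mul2l (x / iota c)); rewrite -eE' -xE.
have gb : left_divides g (f * b).
  by apply/dvd/(prec_mul2l (x / iota c)); rewrite -eE' -yE.
(* The denominator [f] is cleared: the gcd [k] of [f * c] and [f * b] is a multiple [f * h] with [h]
   dividing [d], and [g] divides [k]. Hence [f^-1 g ≼ h ≼ d]. *)
have [k [[c2 c2E] [b2 b2E] kmax]] := garside_left_gcd HM (f * c) (f * b).
have [h kE] : left_divides f k by apply: kmax; [exists c | exists b].
have [h' dE] : left_divides h d.
  apply: dmax; [exists c2 | exists b2]; apply: (garside_cancell HM (a := f)).
    by rewrite c2E kE mulgA.
  by rewrite b2E kE mulgA.
have [g' kE'] := kmax _ gc gb.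
rewrite eE'; apply/prec_mul2l; exists (g' * h'); apply: (mulgI ((iota f)^-1 * iota g)).
rewrite mulVKg -mulgA -iotaM mulgA -kE' kE -mulgA -dE iotaM mulKg //.
Qed.

Lemma meetP x y : is_glb (prec iota) x y (meet iota x y).
Proof. exact: (xgetPex 1 (meet_exists x y)). Qed.

Lemma meetl x y : meet iota x y ≼ x. Proof. by have [] := meetP x y. Qed.
Lemma meetr x y : meet iota x y ≼ y. Proof. by have [] := meetP x y. Qed.
Lemma meet_glb x y e : e ≼ x -> e ≼ y -> e ≼ meet iota x y.
Proof. by have [_ _] := meetP x y; apply. Qed.

Lemma meet_idl x y : x ≼ y -> meet iota x y = x.
Proof.
by move=> xy; apply: prec_anti; [exact: meetl | apply: meet_glb => //; exact: prec_refl].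
Qed.

Lemma meet_idr x y : y ≼ x -> meet iota x y = y.
Proof.
by move=> xy; apply: prec_anti; [exact: meetr | apply: meet_glb => //; exact: prec_refl].
Qed.

(** * Normal forms, and the order characterisation of [inf] and [sup] *)

Section NormalForms.
Hypothesis Delta_neq1 : Delta <> 1.

(** Otherwise antisymmetry makes a positive power of [Delta] equal to 1, which forces
    [Delta = 1]. *)
Lemma expDelta_prec p q : D p ≼ D q -> (p <= q)%R.
Proof.
move=> pq; apply: contrapT => npq; apply: Delta_neq1.
have pqE : D p = D q by apply: prec_anti => //; apply: prec_expDelta; lia.
have : D (p - q)%R = 1 by rewrite expgzD expgzN pqE mulgV.
have -> : (p - q)%R = (`|p - q|.-1.+1)%N by lia.
rewrite /= expgSr => DD1.
have [m DnE] := positive_expDelta `|p - q|.-1; rewrite /= in DnE.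
apply: (mulm_eq1 atM (a := m)); apply: (fractions_inj HG).
by rewrite iotaM iota1 -DnE.
Qed.

(** With [p] maximal and [r] minimal such that [D p ≼ x ≼ D r], the factors are the quotients [f i]
    of successive meets [y i] of [x] with [D (p + i)]. *)
Lemma normal_form_exists x : exists p s, normal_form iota Delta x p s.
Proof.
have [p0 p0x] := lower_bound x; have [r0 xr0] := upper_bound x.
have [||p px pmax] := @int_has_max (fun p => D p ≼ x) r0.
- by exists p0.
- by move=> r rx; apply/expDelta_prec/(prec_trans rx).
have [||r xr rmin] := @int_has_min (fun r => x ≼ D r) p.
- by exists r0.
- by move=> r xr; apply/expDelta_prec/(prec_trans px).
have pr : (p <= r)%R by apply/expDelta_prec/(prec_trans px).
pose y i := meet iota x (D (p + i%:Z)%R).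
have y0 : y 0 = D p by rewrite /y GRing.addr0 meet_idr.
have yS i : exists m, (y i)^-1 * y i.+1 = iota m.
  apply: meet_glb; first exact: meetl.
  by apply: (prec_trans (meetr _ _)); apply: prec_expDelta; lia.
pose f i := xget 1 [set m | (y i)^-1 * y i.+1 = iota m].
have fE i : y i.+1 = y i * iota (f i).
  by rewrite -(xgetPex 1 (yS i)) mulVKg.
have prodf i : D p * \prod_(a <- mkseq f i) iota a = y i.
  elim: i => [|i IH]; first by rewrite big_nil mulg1 y0.
  by rewrite mkseqS -cats1 big_cat big_seq1 /= mulgA IH fE.
(* This makes every factor simple: dividing [y i.+1] by [Delta] on the right gives a lower bound of
   [x] and [D (p + i)]. *)
have yDelta i : y i.+1 ≼ y i * iota Delta.
  have DE : iota Delta = D 1 by rewrite /= expg1.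
  suff : y i.+1 * D (-1)%R ≼ y i.
    by move=> /(prec_mul2r 1); rewrite DE -mulgA -expgzD mulg1.
  apply: meet_glb.
    apply: (prec_trans _ (meetl x (D (p + i.+1%:Z)%R))).
    by rewrite expgzN; apply: prec_mulVr; exact: positive_expDelta.
  have -> : (p + i%:Z)%R = (p + i.+1%:Z + -1)%R by lia.
  by rewrite (expgzD _ (p + _)%R); apply/prec_mul2r/meetr.
exists p, (mkseq f `|r - p|%N); split.
- move=> a /mapP[i]; rewrite mem_iota add0n => /andP[_ ir] ->; split.
  + have [m mE] : iota (f i) ≼ iota Delta.
      by rewrite -(prec_mul2l (y i)) -fE.
    exists m; apply: (fractions_inj HG).
    by rewrite iotaM -mE mulVKg.
  (* If the meets stall at [i], then [x * D (p + i + 1 - r)], which lies below [y i.+1 = y i], lies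
     below [D (p + i)]. Shifting back gives [x ≼ D (r - 1)], against the minimality of [r]. *)
  + move=> fi1; have yi : y i.+1 = y i by rewrite fE fi1 iota1 mulg1.
    suff : x ≼ D (r - 1)%R by move/rmin; lia.
    have xd d : x * D d ≼ D (r + d)%R by rewrite expgzD; exact: prec_mul2r.
    have : x * D (p + i.+1%:Z - r)%R ≼ y i.+1.
      apply: meet_glb; last first.
        by have := xd (p + i.+1%:Z - r)%R; congr (_ ≼ D _); lia.
      rewrite (_ : (_ - r)%R = (- (`|r - p| - i.+1)%N%:Z)%R); last lia.
      by rewrite expgzN; apply/prec_mulVr/positive_expDelta.
    rewrite yi => /prec_trans/(_ (meetr x (D (p + i%:Z)%R))).
    move=> /(prec_mul2r (r - p - i.+1%:Z)%R); rewrite -mulgA -!expgzD.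
    rewrite (_ : (_ + _)%R = 0%R); last lia.
    by rewrite mulg1 (_ : (_ + _)%R = (r - 1)%R); last lia.
  (* A factor [Delta] gives [D (p + 1) ≼ y i * Delta = y i.+1 ≼ x], against the maximality of
     [p]. *)
  + move=> fiD; suff : D (p + 1)%R ≼ x by move/pmax; lia.
    apply: (prec_trans _ (meetl x (D (p + i.+1%:Z)%R))).
    rewrite -/(y _) fE fiD expgzS -[iota Delta]expg1.
    apply: (prec_mul2r 1); apply: meet_glb => //.
    by apply: prec_expDelta; lia.
- rewrite prodf /y (_ : (p + _)%R = r); last lia.
  by rewrite meet_idl.
move=> i; rewrite size_mkseq => ir.
by rewrite -/(y i) -prodf /mkseq -map_take take_iota (minn_idPl ir).
Qed.

(** If [D (p + 1) ≼ x], the meet condition at [i = 1] makes the first factor [Delta], which is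
    excluded. *)
Lemma normal_form_inf x p s :
  normal_form iota Delta x p s -> forall r, D r ≼ x <-> (r <= p)%R.
Proof.
move=> [ss xE meetE] r; split=> [rx|rp]; last first.
  apply: (prec_trans (prec_expDelta rp)); rewrite xE; apply: prec_mulr.
  elim: s {ss xE meetE} => [|a s IH]; first by rewrite big_nil; exact: positive1.
  by rewrite big_cons; apply: positiveM => //; exists a.
apply: contrapT => nrp; have p1x : D (p + 1)%R ≼ x.
  by apply: (prec_trans _ rx); apply: prec_expDelta; lia.
case: s => [|a s] in ss xE meetE *.
  by move: p1x; rewrite xE big_nil mulg1 => /expDelta_prec; lia.
have := meetE 1%N isT; rewrite meet_idr // expgzS /= take0 big_seq1 => /mulgI.
by move=> /(fractions_inj HG) Da; have [_ _ []] := ss a (mem_head _ _).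
Qed.

(** If [x] lay below a smaller power, the meet condition one step before the end would make the last
    factor 1. *)
Lemma normal_form_sup x p s :
  normal_form iota Delta x p s ->
  forall r, x ≼ D r <-> (p + (size s)%:Z <= r)%R.
Proof.
move=> [ss xE meetE] r; split=> [xr|pr]; last first.
  apply: (prec_trans _ (prec_expDelta pr)).
  by rewrite {1}xE -{1}(take_size s) -meetE //; exact: meetr.
apply: contrapT => npr; have {npr}xr : x ≼ D (p + (size s)%:Z - 1)%R.
  by apply: (prec_trans xr); apply: prec_expDelta; lia.
case: (lastP s) => [|s' a] in ss xE meetE xr *.
  by move: xr; rewrite xE big_nil mulg1 => /expDelta_prec /=; lia.
rewrite size_rcons in meetE xr.
rewrite (_ : (_ - 1)%R = (p + (size s')%:Z)%R) in xr; last lia.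
have := meetE (size s') (leqnSn _); rewrite meet_idl // -cats1 take_size_cat //.
rewrite {1}xE -cats1 big_cat big_seq1 /= -[RHS]mulg1 mulgA => /mulgI.
rewrite -iota1 => /(fractions_inj HG) a1.
by have [_ []] := ss a (etrans (mem_rcons _ _ _) (mem_head _ _)).
Qed.

Lemma inf_geP x r : D r ≼ x <-> (r <= inf iota Delta x)%R.
Proof.
have [p [s xps]] := normal_form_exists x.
have [t xt] := xgetPex 0%R (ex_intro (fun p => exists s, _) p (ex_intro _ s xps)).
exact: normal_form_inf xt r.
Qed.

Lemma sup_leP x r : x ≼ D r <-> (sup iota Delta x <= r)%R.
Proof.
have [p [s xps]] := normal_form_exists x; rewrite /sup.
case: xgetP => [_ -> [p' [s' [xps' ->]]]|/(_ (p + (size s)%:Z)%R) []].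
  exact: normal_form_sup xps' r.
by exists p, s.
Qed.

(* Comparing [Delta ^ (p k) ≼ (x ^ u) ^ k] and [x ^ k ≼ Delta ^ (t k)] costs
   a bounded power of [Delta], independent of [k], for conjugating by [u]. *)
Lemma conj_bound x u p t : D p ≼ x ^ u -> x ≼ D t -> (p <= t)%R.
Proof.
move=> pxu xt; have [r ru] := lower_bound u; have [s us] := upper_bound u.
have bound k : (r + p * k%:Z <= t * k%:Z + s)%R.
  apply: expDelta_prec; apply: (@prec_trans (x ^+ k * u)); last first.
    by apply: expM_prec => //; exact: expX_prec.
  have := prec_expX k pxu; rewrite -conjXg => pk.
  by rewrite conjgC; exact: prec_expM.
(* If [t < p], the bound would give [k <= s - r], which this [k] violates. *)
by have := bound `|s - r|.+1; nia.
Qed.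

(** By [conj_bound] the infima of the conjugates are bounded above, so a maximum exists and [xget]
    does not return its default. *)
Lemma inf_s_attained x : exists u, inf_s iota Delta x = inf iota Delta (x ^ u).
Proof.
have [t xt] := upper_bound x; rewrite /inf_s; set A := (inf _ _ @` _)%classic.
have [||p Ap pmax] := @int_has_max A t.
- by exists (inf iota Delta x), x => //; exists 1; rewrite ?conjg1.
- move=> _ [_ [u _ <-] <-]; apply: (@conj_bound x u _ _ _ xt).
  by apply/inf_geP.
have [[_ [u _ <-] <-] _] := xgetI 0%R (conj Ap pmax : (A `&` ubound A)%classic p).
by exists u.
Qed.

Lemma sup_s_attained x : exists u, sup_s iota Delta x = sup iota Delta (x ^ u).
Proof.
have [t tx] := lower_bound x; rewrite /sup_s; set A := (sup _ _ @` _)%classic.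
have [||p Ap pmin] := @int_has_min A t.
- by exists (sup iota Delta x), x => //; exists 1; rewrite ?conjg1.
- move=> _ [_ [u _ <-] <-]; apply: (@conj_bound (x ^ u) u^-1); first by rewrite conjgK.
  by apply/sup_leP.
have [[_ [u _ <-] <-] _] := xgetI 0%R (conj Ap pmin : (A `&` lbound A)%classic p).
by exists u.
Qed.

End NormalForms.

(** * Iterated cycling and periodic elements *)

Local Notation cyc q := (cycling iota Delta q).

Lemma cycling_inf_stable q x : D q ≼ x -> D q ≼ cyc q x.
Proof.
by move=> qx; rewrite /cycling meet_idr // -{1}(expgz_conj _ q q); exact: prec_conj.
Qed.

Lemma cycling_sup_stable q x : x ≼ D q -> cyc q x ≼ D q.
Proof. by move=> xq; rewrite /cycling meet_idl // conjgE mulKg. Qed.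

(* If [v] is positive and [D q ≼ v x v^-1], then [v^-1 D q] is a lower bound of
   [x] and [D q], so [v' = (D q)^-1 v (x ∧ D q)] is again positive, and it
   plays the role of [v] for [cyc q x].  Up to conjugation by a power of
   [Delta], [v'] is a proper left divisor of [v] unless [D q ≼ x]. *)
Lemma cycling_reaches_inf q n w j x :
  is_norm w n -> D q ≼ x ^ (iota w ^ D j)^-1 ->
  exists k, D q ≼ iter k (cyc q) x.
Proof.
elim/ltn_ind: n => n IH in w j x *; set v := iota w ^ D j => wn qv.
case: (pselect (D q ≼ x)) => [qx|nqx]; first by exists 0.
set a := meet iota x (D q).
have vpos : positive v by apply: positive_conj; exists w.
have va : v^-1 * D q ≼ a.
  apply: meet_glb.
    apply: (prec_trans _ (prec_mulVr x vpos)).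
    by apply/(prec_mul2l v); rewrite mulVKg; move: qv; rewrite conjgE invgK mulgA.
  have := positive_conj q vpos.
  by rewrite /prec conjgE invgM invgK mulgA.
have v'pos : positive ((D q)^-1 * v * a).
  by move: va; rewrite /prec invgM invgK.
(* The product of [v'] and [a^-1 * D q] is [v ^ D q], that is [w] twisted by [D (j + q)]. Undoing
   the twist yields [w = w' * b] in the monoid, and the exponent for [w'] becomes [j + q]. *)
have [w' w'E] := positive_conj (- (j + q))%R v'pos.
have [b bE] := positive_conj (- (j + q))%R (meetr x (D q)).
have wE : w = w' * b.
  apply: (fractions_inj HG); rewrite iotaM -w'E -bE -conjMg -/a.
  rewrite (_ : _ * _ * a * _ = v ^ D q); last by rewrite conjgE -!mulgA mulVKg.
  rewrite /v -!conjgM -!expgzD.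
  by rewrite (_ : (_ + _)%R = 0%R) ?conjg1 //; lia.
have bn1 : b <> 1.
  move=> b1; apply: nqx; move/eqP: bE; rewrite b1 iota1 conjg_eq1 => /eqP/mulg1_eq.
  by rewrite invgK => <-; exact: meetl.
have [n' w'n] := atM.2 w'.
have n'n : (n' < n)%N by apply: (norm_mulr_lt atM w'n _ bn1); rewrite -wE.
have [|k qk] := IH _ n'n w' (j + q)%R (cyc q x) w'n.
  rewrite -w'E -conjgM -expgzD GRing.addNr conjg1 /cycling -/a -conjgM.
  (* Undoing [v'] after cycling conjugates [x] by [v^-1 * D q], so the target is the old one
     conjugated by [D q], and it stays above [D q]. *)
  rewrite (_ : a * _ = v^-1 * D q); last first.
    by rewrite invgM [(_ * v)^-1]invgM invgK mulVKg.
  by rewrite conjgM -{1}(expgz_conj _ q q); exact: prec_conj.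
by exists k.+1; rewrite iterSr.
Qed.

(** Here [v' = v * x^-1 * a] satisfies [v = v' * (a^-1 * x)] without any twist, so no exponent is
    carried along. Since [a * v'^-1 = x * v^-1] and [x ^ x = x], the target conjugate does not
    change. *)
Lemma cycling_reaches_sup q n w x :
  is_norm w n -> x ^ (iota w)^-1 ≼ D q ->
  exists k, iter k (cyc q) x ≼ D q.
Proof.
elim/ltn_ind: n => n IH in w x *; set v := iota w => wn vq.
case: (pselect (x ≼ D q)) => [xq|nxq]; first by exists 0.
set a := meet iota x (D q).
have vpos : positive v by exists w.
have va : x * v^-1 ≼ a.
  apply: meet_glb; first exact: prec_mulVr.
  apply: (@prec_trans (v^-1 * D q)).
    by apply/(prec_mul2l v); rewrite mulVKg; move: vq; rewrite conjgE invgK mulgA.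
  have := positive_conj q vpos.
  by rewrite /prec conjgE invgM invgK mulgA.
have [w' w'E] : positive (v * x^-1 * a) by move: va; rewrite /prec invgM invgK.
have [b bE] := meetl x (D q).
have wE : w = w' * b.
  by apply: (fractions_inj HG); rewrite iotaM -w'E -bE -!mulgA mulVKg mulVg mulg1.
have bn1 : b <> 1.
  move=> b1; apply: nxq; move: bE; rewrite b1 iota1 => /mulg1_eq.
  by rewrite invgK => {1}<-; exact: meetr.
have [n' w'n] := atM.2 w'.
have n'n : (n' < n)%N by apply: (norm_mulr_lt atM w'n _ bn1); rewrite -wE.
have [|k qk] := IH _ n'n w' (cyc q x) w'n; last by exists k.+1; rewrite iterSr.
rewrite -w'E /cycling -/a -conjgM (_ : a * _ = x * v^-1).
  by rewrite conjgM [x ^ x]conjgE mulKg.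
by rewrite !invgM invgK mulVKg.
Qed.

(** If [u ≼ D p], then [u * D (- p)] has a positive inverse, a [Delta]-conjugate of [u^-1 * D p]. *)
Lemma conj_by_positiveV x u : exists p w, x ^ (iota w)^-1 = (x ^ u) ^ D p.
Proof.
have [p [w wE]] := upper_bound u.
have [w' w'E] := positive_conj (- p)%R (ex_intro _ w wE).
exists (- p)%R, w'; rewrite -w'E -conjgM; congr (_ ^ _).
rewrite (_ : _ ^ _ = (u * D (- p)%R)^-1) ?invgK //.
by rewrite conjgE invgM expgzN invgK mulgK.
Qed.

Lemma cyclic_set_iter q x k :
  cyclic_set iota Delta q x -> exists i, iter i (cyc q) (iter k (cyc q) x) = x.
Proof.
(* After [k] steps, [k * N - k] more complete [k] full periods. *)
move=> [N N0 xN]; exists (k * N - k)%N; rewrite -iterD subnK ?leq_pmulr //.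
by elim: k => //= k IH; rewrite mulSn iterD IH.
Qed.

Lemma cyclic_set_inf q x u :
  cyclic_set iota Delta q x -> D q ≼ x ^ u -> D q ≼ x.
Proof.
move=> xq qxu; have [p [w xw]] := conj_by_positiveV x u.
have [n wn] := atM.2 w.
have [|k qk] := @cycling_reaches_inf q n w 0%R x wn.
  by rewrite conjg1 xw -(expgz_conj _ q p); exact: prec_conj.
have [i <-] := cyclic_set_iter k xq.
by elim: i => //= i IH; exact: cycling_inf_stable.
Qed.

Lemma cyclic_set_sup q x u :
  cyclic_set iota Delta q x -> x ^ u ≼ D q -> x ≼ D q.
Proof.
move=> xq xuq; have [p [w xw]] := conj_by_positiveV x u.
have [n wn] := atM.2 w.
have [|k qk] := @cycling_reaches_sup q n w x wn.
  by rewrite xw -(expgz_conj _ q p); exact: prec_conj.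
have [i <-] := cyclic_set_iter k xq.
by elim: i => //= i IH; exact: cycling_sup_stable.
Qed.

Lemma eq1_of_Delta_eq1 x : Delta = 1 -> x = 1.
Proof.
move=> D1; have expD1 p : D p = 1.
  by rewrite D1 iota1; case: p => n; rewrite /= expg1n ?invg1.
have [p px] := lower_bound x; have [r xr] := upper_bound x.
by apply: prec_anti; [move: xr | move: px]; rewrite expD1.
Qed.

End GarsideGroupOrder.

Theorem theorem3p2 (M : monoidType) (G : groupType) (iota : M -> G) (Delta : M)
    (HM : garside_monoid Delta) (HG : group_of_fractions iota)
    (x : G) (q : int) :
  ((inf iota Delta x < q)%R /\ (q <= inf_s iota Delta x)%R) \/
  ((sup_s iota Delta x <= q)%R /\ (q < sup iota Delta x)%R) ->
  ~ cyclic_set iota Delta q x.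
Proof.
case: (pselect (Delta = 1%g)) => [D1|Dn1] xq xcyc.
  (* When [Delta = 1] the group is trivial, so [inf_s] and [sup_s] agree with [inf] and [sup], and
     both strict inequalities fail. *)
  have conjE : conj_class x = [set x]%classic.
    apply/seteqP; split=> y.
      by rewrite /= (eq1_of_Delta_eq1 HM HG y D1) (eq1_of_Delta_eq1 HM HG x D1).
    by move=> ->; exists 1%g => //; rewrite conjg1.
  have xgetE (B : set int) (b : int) : B b -> xget 0%R ([set b] `&` B)%classic = b.
    by move=> Bb; apply: xget_unique => // c [].
  move: xq; rewrite /inf_s /sup_s conjE !image_set1 !xgetE => [|_ ->|_ ->] //.
  by lia.
case: xq => [[xq qx]|[xq qx]].
  have [u infE] := inf_s_attained HM HG Dn1 x; rewrite infE in qx.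
  have /(inf_geP HM HG Dn1) : prec iota (expgz (iota Delta) q) x.
    by apply: (cyclic_set_inf HM HG (u := u) xcyc); apply/(inf_geP HM HG Dn1).
  by lia.
have [u supE] := sup_s_attained HM HG Dn1 x; rewrite supE in xq.
have /(sup_leP HM HG Dn1) : prec iota x (expgz (iota Delta) q).
  by apply: (cyclic_set_sup HM HG (u := u) xcyc); apply/(sup_leP HM HG Dn1).
by lia.
Qed.
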